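(* Let $n \ge 2$ and $1 \le k \le n$ be integers. Then the coefficient of $t^k$ in the polynomial $\Omega(Z_n; t - \tfrac12)$ satisfies \[ n!\,[t^k]\,\Omega\!\left(Z_n; t-\tfrac12\right) \;=\; \frac{n!}{k!}\,E_k \sum_{\mu \in \mathsf{SDecompo}_k(Z_n)} w(\mu), \qquad\text{equivalently}\qquad [t^k]\,\Omega\!\left(Z_n; t-\tfrac12\right)=\frac{E_k}{k!}\sum_{\mu \in \mathsf{SDecompo}_k(Z_n)} w(\mu). \]
   Context: The zigzag poset $Z_n$ has ground set $\{z_1,\dots,z_n\}$ and cover relations $z_1 > z_2 < z_3 > z_4 < \cdots$, i.e. $z_{2i-1} > z_{2i}$ and $z_{2i} < z_{2i+1}$ whenever the indices lie in $\{1,\dots,n\}$. For a finite poset $P$, the order polynomial $\Omega(P;t)$ is the unique polynomial such that for every positive integer $t$, $\Omega(P;t)$ is the number of maps $f:P\to\{1,\dots,t\}$ with $f(x)\le f(y)$ whenever $x \preceq y$. The Euler number $E_k$ is the number of linear extensions of $Z_k$ (so $\sum_k E_k z^k/k! = \tan z + \sec z$). $\mathsf{SDecompo}_k(Z_n)$ is the set of standard decompositions of $Z_n$ into $k$ convex (connected) subposets; for the zigzag poset these are exactly the partitions of $\{z_1,\dots,z_n\}$ into $k$ nonempty blocks each consisting of consecutive elements $\{z_a, z_{a+1},\dots,z_b\}$. Weights: define power series $W_+(z)=\sum w_+(m)z^m = \frac{2\arcsin(z/2)}{\sqrt{1-z^2/4}}$, $W_-(z)=\sum w_-(m) z^m =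 2\arcsin(z/2)\sqrt{1-z^2/4}$, $U(z)=\sum U_m z^m = 2\arcsin(z/2)$ (all odd series). For a block $B=\{z_a,\dots,z_b\}$ of a decomposition of $Z_n$, with $m=b-a+1$: if $m$ is even, $w(B)=0$; if $m$ is odd and $B$ has more maximal than minimal elements (i.e. $a$ odd), $w(B)=w_-(m)$; if $m$ is odd, $B$ has more minimal than maximal elements (i.e. $a$ even) and $B$ is special, meaning $n$ is even and $b=n$ (the block is the rightmost one), then $w(B)=U_m$; if $m$ is odd, $a$ even and $B$ is not special, $w(B)=w_+(m)$. (Singleton blocks get weight $1$ in every case.) For a decomposition $\mu$, $w(\mu)=\prod_{B\in\mu} w(B)$. *)

(* Defs.v *)
From HB Require Import structures.
From mathcomp Require Import all_boot all_order all_algebra.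
From mathcomp Require Import ring.

Set Implicit Arguments.
Unset Strict Implicit.
Unset Printing Implicit Defensive.

Import Order.TTheory GRing.Theory Num.Theory.
Local Open Scope ring_scope.

(** * Order polynomial and linear extensions of a finite poset *)

(* The chain {1, ..., t} is represented by 'I_t. *)
Definition order_preserving (d : Order.disp_t) (P : finPOrderType d) (t : nat)
    (f : {ffun P -> 'I_t}) : bool :=
  [forall x : P, forall y : P, (x <= y)%O ==> (f x <= f y)%N].

Definition is_order_poly (d : Order.disp_t) (P : finPOrderType d)
    (p : {poly rat}) : Prop :=
  forall t : nat, (0 < t)%N ->
    p.[t%:R] = #|[set f : {ffun P -> 'I_t} | order_preserving f]|%:R.

Definition linear_extensions (d : Order.disp_t) (P : finPOrderType d) :
    {set {ffun P -> 'I_#|P|}} :=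
  [set f : {ffun P -> 'I_#|P|} | injectiveb f && order_preserving f].

Section OrderPolyExists.

Variables (d : Order.disp_t) (P : finPOrderType d).

Let bin_poly (j : nat) : {poly rat} :=
  (j`!%:R)^-1 *: \prod_(i < j) ('X - i%:R%:P).

Let bin_polyE j t : (bin_poly j).[t%:R] = 'C(t, j)%:R.
Proof.
have E : \prod_(i < j) ((t%:R : rat) - i%:R) = (t ^_ j)%:R.
  elim: j => [|j IHj]; first by rewrite big_ord0 ffactn0.
  rewrite big_ord_recr /= IHj ffactnSr natrM.
  have [le_jt | lt_tj] := leqP j t; first by rewrite natrB.
  by rewrite ffact_small // !mul0r.
rewrite /bin_poly hornerZ horner_prod.
under eq_bigr do rewrite hornerXsubC.
rewrite E -bin_ffact natrM mulrC mulfK // pnatr_eq0 -lt0n.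
exact: fact_gt0.
Qed.

Let surj_maps (j : nat) : {set {ffun P -> 'I_j}} :=
  [set f : {ffun P -> 'I_j} | order_preserving f & f @: setT == setT].

Let card_maps_onto t (A : {set 'I_t}) :
  #|[set f : {ffun P -> 'I_t} | order_preserving f & f @: setT == A]|
  = #|surj_maps #|A| |.
Proof.
pose g (h : {ffun P -> 'I_#|A|}) : {ffun P -> 'I_t} :=
  [ffun x => Order.enum_val (h x)].
have gE h x : g h x = Order.enum_val (h x) by rewrite ffunE.
have g_mono h x y : (g h x <= g h y)%N = (h x <= h y)%N.
  rewrite !gE.
  have tot : total (<=%O : rel 'I_t) by move=> i j; exact: leq_total.
  exact: (Order.le_enum_val tot (h x) (h y)).
have g_inj : injective g.
  move=> h1 h2 /ffunP E; apply/ffunP => x.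
  by have := E x; rewrite !ffunE => /Order.enum_val_inj.
rewrite -(card_imset _ g_inj); apply: eq_card => f.
rewrite !inE; apply/andP/imsetP => [[/forallP mf /eqP imf] | [h]].
  have fA x : f x \in A by rewrite -imf imset_f.
  have [x0 _ | P0] := pickP (@predT P); last first.
    have A0 : A = set0.
      by apply/eqP; rewrite -imf -subset0; apply/subsetP=> ? /imsetP[x]; have := P0 x.
    have h : {ffun P -> 'I_#|A|} by apply: finfun => x; have := P0 x.
    exists h; last by apply/ffunP => x; have := P0 x.
    rewrite inE; apply/andP; split; first by apply/forallP => x; have := P0 x.
    apply/eqP/setP => i; exfalso; move: i; rewrite A0 cards0.
    by case.
  pose h : {ffun P -> 'I_#|A|} :=
    [ffun x => Order.enum_rank_in (fA x0) (f x)].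
  have gh : f = g h.
    by apply/ffunP => x; rewrite !ffunE Order.enum_rankK_in.
  exists h => //; rewrite inE; apply/andP; split.
    apply/forallP => x; apply/forallP => y; apply/implyP => le_xy.
    have /forallP/(_ y)/implyP/(_ le_xy) := mf x.
    by rewrite {1 2}gh g_mono.
  apply/eqP/setP => i; rewrite in_setT; apply/imsetP.
  have sub : A \subset f @: setT by rewrite imf.
  have /imsetP[x _ Ex] := subsetP sub _ (Order.enum_valP i); exists x => //.
  by rewrite ffunE -Ex Order.enum_valK_in.
rewrite inE => /andP[/forallP mh /eqP imh] ->; split.
  apply/forallP => x; apply/forallP => y; apply/implyP => le_xy.
  have /forallP/(_ y)/implyP/(_ le_xy) := mh x.
  by rewrite g_mono.
apply/eqP/setP => i; apply/imsetP/idP => [[x _ ->] | iA].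
  by rewrite ffunE Order.enum_valP.
have : Order.enum_rank_in iA i \in h @: setT by rewrite imh in_setT.
by case/imsetP => x _ Ex; exists x => //; rewrite ffunE -Ex Order.enum_rankK_in.
Qed.

Lemma order_poly_exists : {p : {poly rat} | is_order_poly P p}.
Proof.
exists (\sum_(j < #|P|.+1) #|surj_maps j|%:R *: bin_poly j) => t _.
rewrite horner_sum.
under eq_bigr do rewrite hornerZ bin_polyE.
have -> : #|[set f : {ffun P -> 'I_t} | order_preserving f]|
        = (\sum_(A : {set 'I_t}) #|surj_maps #|A| |)%N.
  rewrite -sum1_card (partition_big (fun f : {ffun P -> 'I_t} => f @: setT)
    predT) //=.
  apply: eq_bigr => A _; rewrite -card_maps_onto -sum1_card.
  by apply: eq_bigl => f; rewrite !inE.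
have small (A : {set 'I_t}) : (#|P| < #|A|)%N -> #|surj_maps #|A| | = 0%N.
  move=> lt_PA; apply/eqP; rewrite cards_eq0 -subset0; apply/subsetP => f.
  rewrite !inE => /andP[_ /eqP /(congr1 (fun S : {set 'I_#|A|} => #|S|))].
  rewrite cardsT card_ord => E; move: lt_PA.
  by rewrite -E ltnNge (leq_trans (leq_imset_card _ _)) // cardsT.
rewrite (bigID (fun A : {set 'I_t} => #|A| < #|P|.+1)%N) /=.
rewrite [X in (_ + X)%N]big1 ?addn0; last first.
  by move=> A; rewrite -leqNgt => /small.
rewrite (partition_big (fun A : {set 'I_t} => inord #|A| : 'I_(#|P|.+1)) predT) //=.
rewrite natr_sum; apply: eq_bigr => j _.
rewrite -natrM; congr (_%:R).
have -> : 'C(t, j) = #|[set A : {set 'I_t} | #|A| == j]|.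
  by rewrite card_draws card_ord.
rewrite mulnC -sum1_card big_distrl /=; apply: eq_big => [A | A].
  rewrite inE; apply/eqP/andP => [EA | [lt_A /eqP EA]].
    by rewrite EA ltn_ord inord_val.
  by rewrite -EA inordK.
by rewrite inE => /eqP ->; rewrite mul1n.
Qed.

End OrderPolyExists.

Lemma is_order_poly_uniq (d : Order.disp_t) (P : finPOrderType d)
    (p q : {poly rat}) : is_order_poly P p -> is_order_poly P q -> p = q.
Proof.
move=> hp hq; apply/eqP; rewrite -subr_eq0; apply/negPn/negP => nz.
pose rs := [seq (i.+1)%:R : rat | i <- iota 0 (size (p - q))].
have: (size rs < size (p - q)%R)%N.
  apply: max_poly_roots => //.
    by apply/allP => _ /mapP[i _ ->]; rewrite rootE hornerD hornerN hp // hq // subrr.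
  rewrite map_inj_uniq ?iota_uniq // => i j /eqP.
  by rewrite eqr_nat => /eqP[].
by rewrite size_map size_iota ltnn.
Qed.

Definition order_poly (d : Order.disp_t) (P : finPOrderType d) : {poly rat} :=
  sval (order_poly_exists P).

Lemma order_polyP (d : Order.disp_t) (P : finPOrderType d) :
  is_order_poly P (order_poly P).
Proof. exact: svalP. Qed.

(** * The zigzag poset *)

(* The ordinal i : 'I_n stands for z_(i+1). *)
Definition zigzag (n : nat) : Type := 'I_n.

HB.instance Definition _ (n : nat) := Finite.on (zigzag n).

Definition zidx (n : nat) (x : zigzag n) : nat := (nat_of_ord x).+1.

(* The relation z_i < z_j: i is even and j = i - 1 or j = i + 1; since no chain
   has more than two elements, the covers already form a transitive relation. *)
Definition zigzag_lt (n : nat) : rel (zigzag n) := fun x y =>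
  ~~ odd (zidx x) && ((zidx x == (zidx y).+1) || (zidx y == (zidx x).+1)).

Lemma zigzag_lt_odd (n : nat) (x y : zigzag n) : zigzag_lt x y -> odd (zidx y).
Proof.
case/andP=> ox /orP[] /eqP E; last by rewrite E /= ox.
by move: ox; rewrite E /= negbK.
Qed.

Lemma zigzag_lt_irr (n : nat) : irreflexive (@zigzag_lt n).
Proof.
by move=> x; apply/negP => lt_xx; have := zigzag_lt_odd lt_xx; case/andP: lt_xx => /negP.
Qed.

Lemma zigzag_lt_trans (n : nat) : transitive (@zigzag_lt n).
Proof. by move=> y x z /zigzag_lt_odd oy /andP[/negP]. Qed.

Fact zigzag_display : Order.disp_t. Proof. by split; exact: tt. Qed.

HB.instance Definition _ (n : nat) := Order.Lt_isPOrder.Build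
  zigzag_display (zigzag n) (@zigzag_lt_irr n) (@zigzag_lt_trans n).

Lemma zigzag_ltE (n : nat) (x y : zigzag n) : (x < y)%O = zigzag_lt x y.
Proof. by []. Qed.

Lemma zigzag_leE (n : nat) (x y : zigzag n) :
  (x <= y)%O = (x == y) || zigzag_lt x y.
Proof. exact: le_eqVlt. Qed.

Definition euler_number (k : nat) : nat := #|linear_extensions (zigzag k)|.

(** * Decompositions of the zigzag poset into intervals *)

Definition interval_block (n : nat) (B : {set zigzag n}) : bool :=
  [exists a : zigzag n, exists b : zigzag n,
     B == [set x | zidx a <= zidx x <= zidx b]%N].

Definition SDecompo (k n : nat) : {set {set {set zigzag n}}} :=
  [set mu : {set {set zigzag n}} |
     [&& partition mu [set: zigzag n], #|mu| == k
       & [forall B in mu, interval_block B]]].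

(** * Formal power series with rational coefficients, as coefficient sequences *)

Definition fps_mul (a b : nat -> rat) : nat -> rat :=
  fun n => \sum_(i < n.+1) a i * b (n - i)%N.

(* antiderivative with zero constant term *)
Definition fps_int (a : nat -> rat) : nat -> rat :=
  fun n => if n is m.+1 then a m / m.+1%:R else 0.

(* a(c z) *)
Definition fps_dilate (c : rat) (a : nat -> rat) : nat -> rat :=
  fun n => c ^+ n * a n.

Definition gbinom (alpha : rat) (j : nat) : rat :=
  (\prod_(i < j) (alpha - i%:R)) / j`!%:R.

(* (1 - c z^2)^alpha, by the binomial series *)
Definition fps_pow1B (alpha c : rat) : nat -> rat :=
  fun n => if odd n then 0 else gbinom alpha n./2 * (- c) ^+ n./2.

(* arcsin 0 = 0 and arcsin'(z) = (1 - z^2)^(-1/2) *)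
Definition fps_arcsin : nat -> rat := fps_int (fps_pow1B (- (1 / 2)) 1).

(* U(z) = 2 arcsin(z/2) *)
Definition U_ (m : nat) : rat := 2 * fps_dilate (1 / 2) fps_arcsin m.

(* W_+(z) = 2 arcsin(z/2) / sqrt(1 - z^2/4) *)
Definition w_plus : nat -> rat := fps_mul U_ (fps_pow1B (- (1 / 2)) (1 / 4)).

(* W_-(z) = 2 arcsin(z/2) sqrt(1 - z^2/4) *)
Definition w_minus : nat -> rat := fps_mul U_ (fps_pow1B (1 / 2) (1 / 4)).

(* Exponents of fps_pow1B add up under multiplication, so fps_pow1B (1/2) c and
   fps_pow1B (-(1/2)) c are sqrt(1 - c z^2) and its inverse. *)

Lemma gbinomS (alpha : rat) (j : nat) :
  j.+1%:R * gbinom alpha j.+1 = (alpha - j%:R) * gbinom alpha j.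
Proof.
rewrite /gbinom big_ord_recr /= factS natrM invfM.
have nz : (j.+1%:R : rat) != 0 by rewrite pnatr_eq0.
have nzf : (j`!%:R : rat) != 0 by rewrite pnatr_eq0 -lt0n fact_gt0.
by field; rewrite nzf addrC natr1.
Qed.

Lemma gbinomD (alpha beta : rat) (n : nat) :
  \sum_(i < n.+1) gbinom alpha i * gbinom beta (n - i)%N
  = gbinom (alpha + beta) n.
Proof.
elim: n => [|n IHn].
  by rewrite big_ord1 /gbinom !big_ord0 fact0 invr1 !mulr1.
have nz : (n.+1%:R : rat) != 0 by rewrite pnatr_eq0.
apply: (mulfI nz); rewrite gbinomS -IHn !mulr_sumr.
have -> : \sum_(i < n.+2) n.+1%:R * (gbinom alpha i * gbinom beta (n.+1 - i)%N)
  = \sum_(i < n.+2) (i%:R * gbinom alpha i) * gbinom beta (n.+1 - i)%N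
  + \sum_(i < n.+2) gbinom alpha i *
      ((n.+1 - i)%N%:R * gbinom beta (n.+1 - i)%N).
  rewrite -big_split /=; apply: eq_bigr => i _.
  by rewrite natrB ?leq_ord //; ring.
rewrite big_ord_recl mul0r mul0r add0r [X in _ + X]big_ord_recr /= subnn.
rewrite mul0r mulr0 addr0 -big_split /=; apply: eq_bigr => i _.
have le_in : (i <= n)%N by rewrite -ltnS.
rewrite /bump /= add1n subSS gbinomS (subSn le_in) gbinomS natrB //; ring.
Qed.

Lemma fps_pow1BD (alpha beta c : rat) (n : nat) :
  fps_mul (fps_pow1B alpha c) (fps_pow1B beta c) n
  = fps_pow1B (alpha + beta) c n.
Proof.
rewrite /fps_mul /fps_pow1B; case: ifPn => [on | en].
  apply: big1 => i _; have le_in : (i <= n)%N by rewrite -ltnS.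
  case: ifPn => [|ei]; rewrite ?mul0r // oddB // on (negbTE ei) /=.
  by rewrite mulr0.
rewrite -[n]even_halfK // doubleK; set m := n./2.
rewrite -gbinomD mulr_suml.
rewrite -(big_mkord predT (fun i => (if odd i then 0
   else gbinom alpha i./2 * (- c) ^+ i./2) * (if odd (m.*2 - i) then 0
   else gbinom beta (m.*2 - i)./2 * (- c) ^+ (m.*2 - i)./2))).
rewrite -(big_mkord predT (fun i => gbinom alpha i * gbinom beta (m - i)
   * (- c) ^+ m)).
have even_sum (F : nat -> rat) : (forall i, odd i -> F i = 0) -> forall l,
    \sum_(0 <= i < l.*2.+1) F i = \sum_(0 <= i < l.+1) F i.*2.
  move=> F0; elim=> [|l IHl]; first by rewrite !big_nat1.
  rewrite doubleS big_nat_recr //= big_nat_recr //= IHl F0 /= ?odd_double //.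
  by rewrite addr0 [RHS]big_nat_recr.
rewrite even_sum => [|i ->]; last by rewrite mul0r.
rewrite !big_nat; apply: eq_bigr => i; rewrite ltnS /= => le_im.
have -> : (- c) ^+ m = (- c) ^+ i * (- c) ^+ (m - i) by rewrite -exprD subnKC.
rewrite -doubleB !odd_double !doubleK; ring.
Qed.

Lemma fps_pow1B0 (c : rat) (n : nat) : fps_pow1B 0 c n = (n == 0%N)%:R.
Proof.
rewrite /fps_pow1B /gbinom; case: n => [|[|n]] /=.
- by rewrite big_ord0 fact0 divr1 mul1r.
- by [].
by rewrite big_ord_recl subrr !mul0r if_same.
Qed.

Lemma fps_pow1B1 (c : rat) (n : nat) :
  fps_pow1B 1 c n = (n == 0%N)%:R - c * (n == 2)%:R.
Proof.
rewrite /fps_pow1B /gbinom; case: n => [|[|[|[|n]]]] /=.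
- by rewrite big_ord0 fact0 mulr0 subr0 divr1 mulr1.
- by rewrite mulr0 subr0.
- by rewrite big_ord1 divr1 subr0 mul1r mulr1 add0r.
- by rewrite mulr0 subr0.
by rewrite 2!big_ord_recl /= subrr mul0r mulr0 !mul0r if_same mulr0 subr0.
Qed.

(** * Weights of blocks and of decompositions *)

Section Weights.

Variable n : nat.

(* For an interval block B = {z_a, ..., z_b}: a, b and b - a + 1. *)
Definition block_first (B : {set zigzag n}) : nat :=
  \big[minn/n]_(x in B) zidx x.

Definition block_last (B : {set zigzag n}) : nat := (\max_(x in B) zidx x)%N.

Definition block_size (B : {set zigzag n}) : nat :=
  (block_last B - block_first B).+1.

Definition special (B : {set zigzag n}) : bool :=
  ~~ odd n && (block_last B == n).

Definition block_weight (B : {set zigzag n}) : rat :=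
  let m := block_size B in
  if ~~ odd m then 0
  else if odd (block_first B) then w_minus m
  else if special B then U_ m
  else w_plus m.

Definition weight (mu : {set {set zigzag n}}) : rat :=
  \prod_(B in mu) block_weight B.

End Weights.

(* Main.v *)
(* Put [z = 2 sin t], so that [U = 2 t], and let [rt = cos t].  Odd block sizes
   make the weights alternate between [W_- = U rt] and [W_+ = U / rt], hence the
   decompositions into [k] blocks have generating series [U^k rt].  On the other
   side, reversing the labels at every second element turns order preserving maps
   into sequences in [0, T - 1] whose consecutive terms have sum at least [T - 1];
   a transfer argument gives
     [sum_n Omega(Z_n; T) z^n = (1 + sin (2 T t) / cos t) / (cos ((2 T + 1) t) / cos t)],
   that is [rt h((T + 1/2) U) - z / 2] with [h = sec + tan].  Comparing
   coefficients of powers of [T + 1/2] yields [h_k [z^n] (U^k rt)], and the case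
   [n = k] identifies [h_k] with [E_k / k!], because [#linear extensions / |P|!]
   is the leading coefficient of an order polynomial. *)
Require Import Defs.
From HB Require Import structures.
From mathcomp Require Import all_boot all_order all_algebra.
From mathcomp Require Import boolp zify ring.

Set Implicit Arguments.
Unset Strict Implicit.
Unset Printing Implicit Defensive.

Import Order.TTheory GRing.Theory Num.Theory.
Local Open Scope ring_scope.

(** * Formal power series *)

(** An alias for coefficient sequences that carries the Cauchy product; [U_], [w_plus] and the like
    belong to it by conversion. Equality and choice on it are classical. *)
Definition fps (R : Type) : Type := nat -> R.

HB.instance Definition _ (R : Type) := gen_eqMixin (fps R).
HB.instance Definition _ (R : Type) := gen_choiceMixin (fps R).

Section FpsRing.
Variable R : comNzRingType.
Implicit Types a b c u : fps R.

Lemma fpsP a b : (forall n, a n = b n) -> a = b.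
Proof. by move=> eq_ab; apply: funext. Qed.

Definition fps_zero : fps R := fun=> 0.
Definition fps_opp a : fps R := fun n => - a n.
Definition fps_add a b : fps R := fun n => a n + b n.

Fact fps_addA : associative fps_add.
Proof. by move=> a b c; apply: fpsP => n; rewrite /fps_add addrA. Qed.
Fact fps_addC : commutative fps_add.
Proof. by move=> a b; apply: fpsP => n; rewrite /fps_add addrC. Qed.
Fact fps_add0 : left_id fps_zero fps_add.
Proof. by move=> a; apply: fpsP => n; rewrite /fps_add add0r. Qed.
Fact fps_addN : left_inverse fps_zero fps_opp fps_add.
Proof. by move=> a; apply: fpsP => n; rewrite /fps_add addNr. Qed.

HB.instance Definition _ :=
  GRing.isZmodule.Build (fps R) fps_addA fps_addC fps_add0 fps_addN.

Definition fpsC (x : R) : fps R := fun n => if n is 0%N then x else 0.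
Definition fps_prod a b : fps R := fun n => \sum_(i < n.+1) a i * b (n - i)%N.

Fact fps_prodC : commutative fps_prod.
Proof.
move=> a b; apply: fpsP => n; rewrite /fps_prod (reindex_inj rev_ord_inj) /=.
apply: eq_bigr => i _; rewrite subSS mulrC subKn // -ltnS.
exact: ltn_ord.
Qed.

Fact fps_prodA : associative fps_prod.
Proof.
move=> a b c; apply: fpsP => n; rewrite /fps_prod.
pose G i j := a i * (b j * c (n - i - j)%N).
transitivity (\sum_(i < n.+1) \sum_(j < n.+1 | (i + j <= n)%N) G i j).
  apply: eq_bigr => i _; rewrite mulr_sumr.
  have le_in : (i <= n)%N by rewrite -ltnS.
  rewrite (big_ord_widen n.+1 (G i)) ?ltnS ?leq_subr //.
  by apply: eq_bigl => j; rewrite ltnS leq_subRL.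
(* From here on [j] is the total degree taken from [a] and [b]. *)
transitivity (\sum_(j < n.+1) \sum_(i < n.+1 | (i <= j)%N) G i (j - i)%N).
  rewrite [RHS](exchange_big_dep xpredT) //=; apply: eq_bigr => i _.
  have le_in : (i <= n)%N by rewrite -ltnS.
  rewrite -(big_mkord (fun j => i + j <= n)%N (G i)).
  rewrite -(big_mkord (fun j => i <= j)%N (fun j => G i (j - i)%N)).
  rewrite [RHS](big_cat_nat (n := i)) //= 1?ltnW //.
  rewrite [X in _ = X + _]big1_seq ?add0r; last first.
    by move=> j /andP[le_ij]; rewrite mem_index_iota /= ltnNge le_ij.
  have := big_addn 0 n.+1 i (fun j => i <= j)%N (fun j => G i (j - i)%N).
  rewrite add0n => ->.
  rewrite (big_cat_nat (n := n.+1 - i)) ?leq_subr //= [X in _ + X]big1_seq.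
    rewrite addr0 big_mkcond [RHS]big_mkcond /= !big_nat.
    apply: eq_bigr => j /andP[_ lt_j].
    move: lt_j; rewrite subSn // ltnS leq_subRL // => ->.
    by rewrite addnK leq_addl.
  move=> j /andP[le_ijn]; rewrite mem_index_iota => /andP[le_j _].
  by move: le_j; rewrite leq_subLR ltnNge le_ijn.
apply: eq_bigr => j _; rewrite mulr_suml.
rewrite (big_ord_widen n.+1 (fun i => a i * b (j - i)%N * c (n - j)%N)) //.
apply: eq_bigr => i le_ij.
by rewrite /G mulrA -subnDA subnKC.
Qed.

Fact fps_prod1 : left_id (fpsC 1) fps_prod.
Proof.
move=> a; apply: fpsP => n; rewrite /fps_prod big_ord_recl subn0 mul1r.
by rewrite big1 ?addr0 // => i _; rewrite mul0r.
Qed.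

Fact fps_prodDl : left_distributive fps_prod fps_add.
Proof.
move=> a b c; apply: fpsP => n; rewrite /fps_prod /fps_add -big_split.
by apply: eq_bigr => i _; rewrite /= mulrDl.
Qed.

Fact fps_oner_neq0 : fpsC 1 != 0.
Proof.
apply/eqP => /(congr1 (fun a : fps R => a 0%N)) /= /eqP.
by rewrite oner_eq0.
Qed.

HB.instance Definition _ := GRing.Zmodule_isComNzRing.Build (fps R)
  fps_prodA fps_prodC fps_prod1 fps_prodDl fps_oner_neq0.

Lemma fpsD a b n : (a + b) n = a n + b n. Proof. by []. Qed.
Lemma fpsN a n : (- a) n = - a n. Proof. by []. Qed.
Lemma fps1 n : (1 : fps R) n = (n == 0%N)%:R. Proof. by case: n. Qed.
Lemma fpsM a b n : (a * b) n = \sum_(i < n.+1) a i * b (n - i)%N.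
Proof. by []. Qed.

Lemma fpsM0 a b : (a * b) 0%N = a 0%N * b 0%N.
Proof. by rewrite fpsM big_ord1. Qed.

Fact fpsC_additive : zmod_morphism fpsC.
Proof. by move=> x y; apply: fpsP => -[|n]; rewrite fpsD fpsN //= subr0. Qed.
HB.instance Definition _ := GRing.isZmodMorphism.Build R (fps R) fpsC fpsC_additive.

Lemma fpsCM x a n : (fpsC x * a) n = x * a n.
Proof.
rewrite fpsM big_ord_recl subn0 big1 ?addr0 // => i _.
by rewrite mul0r.
Qed.

Fact fpsC_multiplicative : monoid_morphism fpsC.
Proof.
split=> // x y; apply: fpsP => n; rewrite fpsCM.
by case: n => //= n; rewrite mulr0.
Qed.
HB.instance Definition _ :=
  GRing.isMonoidMorphism.Build R (fps R) fpsC fpsC_multiplicative.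

Definition fpsX : fps R := fun n => (n == 1%N)%:R.

Lemma fpsXM a n : (fpsX * a) n = if n is m.+1 then a m else 0.
Proof.
rewrite fpsM; case: n => [|n]; first by rewrite big_ord1 mul0r.
rewrite big_ord_recl mul0r add0r big_ord_recl mul1r /bump /= subn1 /=.
by rewrite big1 ?addr0 // => i _; rewrite mul0r.
Qed.

(** Since [c] has constant term 1, coefficient [n] of [c * a] is [a n] plus terms in earlier
    coefficients of [a], which strong induction cancels. *)
Lemma fps_mulI a b c : c 0%N = 1 -> c * a = c * b -> a = b.
Proof.
move=> c0 eq_ab; apply: fpsP => n.
elim/ltn_ind: n => n IH; have := congr1 (fun d : fps R => d n) eq_ab.
rewrite /= !fpsM !big_ord_recl subn0 c0 !mul1r.
set x := \sum_(i < n) _; set y := \sum_(i < n) _; suff -> : x = y by move/addIr.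
apply: eq_bigr => i _; congr (_ * _); apply: IH.
by rewrite /bump /= ltn_subrL /=; case: n i {x y} => // -[].
Qed.

(** * Formal derivative, order of vanishing and composition *)

Definition fps_deriv a : fps R := fun n => a n.+1 *+ n.+1.

Lemma fps_derivD a b : fps_deriv (a + b) = fps_deriv a + fps_deriv b.
Proof. by apply: fpsP => n; rewrite /fps_deriv !fpsD mulrnDl. Qed.

Lemma fps_derivN a : fps_deriv (- a) = - fps_deriv a.
Proof. by apply: fpsP => n; rewrite /fps_deriv !fpsN mulNrn. Qed.

Lemma fps_derivC x : fps_deriv (fpsC x) = 0.
Proof. by apply: fpsP => n; rewrite /fps_deriv /= mul0rn. Qed.

Lemma fps_derivX : fps_deriv fpsX = 1.
Proof.
by apply: fpsP => -[|n]; rewrite /fps_deriv /fpsX fps1 ?eqSS //= mul0rn.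
Qed.

Lemma fps_derivM a b : fps_deriv (a * b) = fps_deriv a * b + a * fps_deriv b.
Proof.
apply: fpsP => n; rewrite /fps_deriv fpsD !fpsM.
have -> : (\sum_(i < n.+2) a i * b (n.+1 - i)%N) *+ n.+1 =
  \sum_(i < n.+2) (a i *+ i) * b (n.+1 - i)%N
  + \sum_(i < n.+2) a i * (b (n.+1 - i)%N *+ (n.+1 - i)).
  rewrite -sumrMnl -big_split /=; apply: eq_bigr => i _.
  by rewrite mulrnAl mulrnAr -mulrnDr subnKC // -ltnS.
congr (_ + _).
  by rewrite big_ord_recl mulr0n mul0r add0r.
rewrite big_ord_recr /= subnn mulr0n mulr0 addr0.
by apply: eq_bigr => i _; rewrite subSn // -ltnS.
Qed.

Lemma fps_expr_small a k n : a 0%N = 0 -> (n < k)%N -> (a ^+ k) n = 0.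
Proof.
move=> a0; elim: k n => // k IH n lt_nk; rewrite exprS fpsM big1 // => -[i lt_i] _ /=.
case: i lt_i => [|i] lt_i; first by rewrite a0 mul0r.
by rewrite IH ?mulr0 //; lia.
Qed.

Lemma fps_expr_diag a k : a 0%N = 0 -> (a ^+ k) k = a 1%N ^+ k.
Proof.
move=> a0; elim: k => [|k IH]; first by rewrite !expr0 fps1.
rewrite exprS fpsM 2!big_ord_recl a0 mul0r add0r /bump /= subSS subn0 IH -exprS.
rewrite big1 ?addr0 // => i _; rewrite fps_expr_small ?mulr0 //.
by have := ltn_ord i; rewrite /bump /=; lia.
Qed.

(* Composition [a(u)]; the truncation of the sum is harmless only if [u 0 = 0]. *)
Definition fps_comp a u : fps R := fun n => \sum_(k < n.+1) a k * (u ^+ k) n.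

Lemma fps_comp_widen a u n m : u 0%N = 0 -> (n <= m)%N ->
  fps_comp a u n = \sum_(k < m.+1) a k * (u ^+ k) n.
Proof.
move=> u0 le_nm; rewrite /fps_comp (big_ord_widen m.+1 (fun k => a k * (u ^+ k) n)) //.
rewrite big_mkcond; apply: eq_bigr => k _; case: ltnP => // lt_nk.
by rewrite fps_expr_small ?mulr0.
Qed.

Lemma fps_compD a b u : fps_comp (a + b) u = fps_comp a u + fps_comp b u.
Proof.
by apply: fpsP => n; rewrite fpsD -big_split; apply: eq_bigr => k _; rewrite /= -mulrDl.
Qed.

Lemma fps_compN a u : fps_comp (- a) u = - fps_comp a u.
Proof.
by apply: fpsP => n; rewrite fpsN -sumrN; apply: eq_bigr => k _; rewrite /= -mulNr.
Qed.

Lemma fps_compC x u : fps_comp (fpsC x) u = fpsC x.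
Proof.
apply: fpsP => n; rewrite /fps_comp big_ord_recl expr0 big1 => [|k _]; last first.
  by rewrite mul0r.
by case: n => [|n]; rewrite addr0 fps1 ?mulr1 ?mulr0.
Qed.

Lemma fps_comp1 u : fps_comp 1 u = 1.
Proof. exact: fps_compC. Qed.

Lemma fps_compX u : u 0%N = 0 -> fps_comp fpsX u = u.
Proof.
move=> u0; apply: fpsP => n; rewrite (@fps_comp_widen _ _ n n.+1) //.
rewrite 2!big_ord_recl mul0r add0r mul1r expr1 big1 ?addr0 // => k _.
by rewrite mul0r.
Qed.

(** Both sides sum [a k * b l * (u ^+ (k + l)) n], one over [k + l <= n], the other over a square;
    the extra terms vanish because [u ^+ (k + l)] has order at least [k + l]. *)
Lemma fps_compM a b u : u 0%N = 0 ->
  fps_comp (a * b) u = fps_comp a u * fps_comp b u.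
Proof.
move=> u0; apply: fpsP => n; rewrite fpsM.
pose G k l := a k * b l * (u ^+ (k + l)) n.
transitivity (\sum_(k < n.+1) \sum_(l < n.+1) G k l); last first.
  rewrite [RHS](eq_bigr (fun i : 'I_n.+1 => \sum_(k < n.+1) \sum_(l < n.+1)
     a k * b l * ((u ^+ k) i * (u ^+ l) (n - i)%N))); last first.
    move=> i _; rewrite (@fps_comp_widen a u i n) ?leq_ord //.
    rewrite (@fps_comp_widen b u (n - i)%N n) ?leq_subr // big_distrlr /=.
    by apply: eq_bigr => k _; apply: eq_bigr => l _; rewrite mulrACA.
  rewrite [RHS]exchange_big; apply: eq_bigr => k _.
  rewrite [RHS]exchange_big; apply: eq_bigr => l _.
  by rewrite /G exprD fpsM mulr_sumr.
rewrite /fps_comp.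
transitivity (\sum_(m < n.+1) \sum_(k < n.+1 | (k <= m)%N) G k (m - k)%N).
  apply: eq_bigr => m _; rewrite fpsM mulr_suml.
  rewrite (big_ord_widen n.+1 (fun k => a k * b (m - k)%N * (u ^+ m) n)) //.
  by apply: eq_bigr => k le_km; rewrite /G subnKC.
rewrite (exchange_big_dep xpredT) //=; apply: eq_bigr => k _.
have le_kn : (k <= n)%N by rewrite -ltnS.
rewrite -(big_mkord (fun m => k <= m)%N (fun m => G k (m - k)%N)).
rewrite -(big_mkord xpredT (G k)).
rewrite (big_cat_nat (n := k)) //= 1?ltnW // big1_seq ?add0r; last first.
  by move=> j /andP[le_kj]; rewrite mem_index_iota /= ltnNge le_kj.
have := big_addn 0 n.+1 k (fun m => k <= m)%N (fun m => G k (m - k)%N).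
rewrite add0n => ->; rewrite [RHS](big_cat_nat (n := n.+1 - k)) ?leq_subr //=.
rewrite [X in _ = _ + X]big1_seq ?addr0.
  by apply: eq_big => [j|j _]; rewrite ?leq_addl // addnK.
move=> l; rewrite mem_index_iota => /andP[_ /andP[le_l _]].
by rewrite /G fps_expr_small ?mulr0 //; lia.
Qed.

Lemma fps_derivXn u k : fps_deriv (u ^+ k.+1) = (u ^+ k *+ k.+1) * fps_deriv u.
Proof.
elim: k => [|k IH]; first by rewrite expr1 expr0 mul1r.
by rewrite exprS fps_derivM IH [u ^+ k.+1]exprS; ring.
Qed.

Lemma fps_deriv_comp a u : u 0%N = 0 ->
  fps_deriv (fps_comp a u) = fps_comp (fps_deriv a) u * fps_deriv u.
Proof.
move=> u0; apply: fpsP => n; rewrite fpsM.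
under eq_bigr => i _ do
  rewrite (@fps_comp_widen _ u i n) ?leq_ord // mulr_suml.
rewrite exchange_big /fps_deriv /fps_comp -sumrMnl big_ord_recl expr0 fps1.
rewrite mulr0 mul0rn add0r; apply: eq_bigr => k _ /=.
rewrite /bump /= add1n -mulrnAr -[_ *+ n.+1]/(fps_deriv (u ^+ k.+1) n).
rewrite fps_derivXn fpsM mulr_sumr; apply: eq_bigr => i _.
have -> : (u ^+ k *+ k.+1) i = (u ^+ k) i *+ k.+1.
  by elim: k.+1 => // m IH; rewrite !mulrS fpsD IH.
by rewrite -/(fps_deriv u) !mulrnAl mulrnAr !mulrA.
Qed.

Lemma fps_comp0 a u : fps_comp a u 0%N = a 0%N.
Proof. by rewrite /fps_comp big_ord1 expr0 fps1 mulr1. Qed.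

Lemma fps_inv_exists a : a 0%N = 1 -> exists b, b * a = 1.
Proof.
move=> a0; have u0 : (1 - a) 0%N = 0 by rewrite fpsD fpsN fps1 a0 subrr.
(* The geometric series [1 / (1 - z)] taken at [1 - a]. *)
exists (fps_comp (fun=> 1) (1 - a)).
have {2}-> : a = fps_comp (1 - fpsX) (1 - a).
  by rewrite fps_compD fps_compN fps_comp1 fps_compX // subKr.
rewrite -fps_compM // -[RHS](fps_comp1 (1 - a)); congr fps_comp.
apply: fpsP => n; rewrite mulrBr mulr1 mulrC fpsD fpsN fpsXM fps1.
by case: n => [|n]; rewrite ?subr0 ?subrr.
Qed.

End FpsRing.

(** * Trigonometric series in [U] *)

(** The system determines each coefficient from earlier ones. Trigonometric identities follow by
    applying this to the difference of two solutions of one rotation system. *)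
Lemma fps_rotation_uniq (a y1 y2 : fps rat) : y1 0%N = 0 -> y2 0%N = 0 ->
  fps_deriv y1 = - (a * y2) -> fps_deriv y2 = a * y1 -> y1 = 0 /\ y2 = 0.
Proof.
move=> y10 y20 d1 d2.
have coef_eq0 (y : fps rat) n : fps_deriv y n = 0 -> y n.+1 = 0.
  by rewrite /fps_deriv => /eqP; rewrite mulrn_eq0 /= => /eqP.
suff y0 n : y1 n = 0 /\ y2 n = 0 by split; apply: fpsP => n; case: (y0 n).
elim/ltn_ind: n => -[|n] IH //.
split; apply: coef_eq0; rewrite ?d1 ?d2 ?fpsN fpsM big1 ?oppr0 // => i _.
  by rewrite (IH (n - i)%N _).2 ?mulr0 // ltnS leq_subr.
by rewrite (IH (n - i)%N _).1 ?mulr0 // ltnS leq_subr.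
Qed.

Lemma fps_dilateM (x : rat) (a b : fps rat) :
  fps_dilate x (a * b) = (fps_dilate x a : fps rat) * fps_dilate x b.
Proof.
apply: fpsP => n; rewrite /fps_dilate !fpsM mulr_sumr; apply: eq_bigr => i _.
by rewrite mulrACA -exprD subnKC ?leq_ord.
Qed.

Lemma fps_dilateD (x : rat) (a b : fps rat) :
  fps_dilate x (a + b) = (fps_dilate x a : fps rat) + fps_dilate x b.
Proof. by apply: fpsP => n; rewrite /fps_dilate !fpsD mulrDr. Qed.

Lemma fps_dilate1 (x : rat) : fps_dilate x (1 : fps rat) = (1 : fps rat).
Proof.
by apply: fpsP => -[|n]; rewrite /fps_dilate fps1 ?expr0 ?mulr1 ?mulr0.
Qed.

Definition fps_cos : fps rat :=
  fun n => if odd n then 0 else (-1) ^+ n./2 / n`!%:R.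
Definition fps_sin : fps rat :=
  fun n => if odd n then (-1) ^+ n./2 / n`!%:R else 0.

Lemma factS_div (x : rat) (n : nat) : x / (n.+1)`!%:R *+ n.+1 = x / n`!%:R.
Proof.
rewrite factS natrM -mulr_natr; field.
by rewrite pnatr_eq0 -lt0n fact_gt0 addrC natr1 pnatr_eq0.
Qed.

Lemma fps_deriv_dilate_cos (x : rat) :
  fps_deriv (fps_dilate x fps_cos) = - (fpsC x * fps_dilate x fps_sin).
Proof.
apply: fpsP => n; rewrite fpsN fpsCM /fps_deriv /fps_dilate /fps_cos /fps_sin /=.
case: (boolP (odd n)) => on /=; last by rewrite !mulr0 mul0rn oppr0.
by rewrite -mulrnAr factS_div uphalf_half on add1n !exprS; ring.
Qed.

Lemma fps_deriv_dilate_sin (x : rat) :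
  fps_deriv (fps_dilate x fps_sin) = fpsC x * fps_dilate x fps_cos.
Proof.
apply: fpsP => n; rewrite fpsCM /fps_deriv /fps_dilate /fps_cos /fps_sin /=.
case: (boolP (odd n)) => on /=; first by rewrite !mulr0 mul0rn.
by rewrite -mulrnAr factS_div uphalf_half (negbTE on) !exprS; ring.
Qed.

Local Notation U := (U_ : fps rat).
(* [rt] is [sqrt (1 - z^2 / 4)], [rti] its inverse, and [hz] is [z / 2]. *)
Local Notation rt := (fps_pow1B (1 / 2) (1 / 4) : fps rat).
Local Notation rti := (fps_pow1B (- (1 / 2)) (1 / 4) : fps rat).
Local Notation hz := (fpsC (1 / 2) * fpsX rat).

Lemma fpsC_halfK : fpsC (1 / 2 : rat) *+ 2 = 1.
Proof. by rewrite -rmorphMn. Qed.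

Lemma fpsX_half : fpsX rat = hz *+ 2.
Proof. by rewrite -mulrnAl fpsC_halfK mul1r. Qed.

Lemma rt_rti : rt * rti = 1.
Proof.
apply: fpsP => n; rewrite fps1 -(fps_pow1B0 (1 / 4)).
by rewrite -[RHS]/(fps_pow1B 0 (1 / 4) n) -[0 in RHS](subrr (1 / 2)) -fps_pow1BD.
Qed.

Lemma rt_sqr : rt * rt = 1 - hz * hz.
Proof.
have -> : hz * hz = fpsC (1 / 4) * (fpsX rat * fpsX rat).
  rewrite mulrACA -rmorphM; congr (fpsC _ * _).
apply: fpsP => n; rewrite fpsD fpsN fpsCM fpsXM fps1.
transitivity (fps_pow1B 1 (1 / 4) n).
  by rewrite (_ : 1 = 1 / 2 + 1 / 2 :> rat) -?fps_pow1BD.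
by rewrite fps_pow1B1; case: n => [|[|[|n]]].
Qed.

Lemma U_0 : U 0%N = 0.
Proof. by rewrite /U_ /fps_dilate /= !mulr0. Qed.

Lemma fps_deriv_U : fps_deriv U = rti.
Proof.
apply: fpsP => n; rewrite /fps_deriv /U_ /fps_dilate /fps_arcsin /=.
rewrite /fps_pow1B; case: ifP => on; first by rewrite mul0r !mulr0 mul0rn.
(* Here [n] is even, so the dilation by 1/2 turns [1 - z^2] into [1 - z^2 / 4]. *)
have -> : (1 / 2 : rat) ^+ n.+1 = (1 / 2) * (1 / 4) ^+ n./2.
  rewrite exprS -[n in LHS]odd_double_half on add0n -muln2 mulnC exprM.
  by congr (_ * _ ^+ _).
rewrite -mulr_natr; have -> : (- (1 / 4) : rat) ^+ n./2 = (-1) ^+ n./2 * (1 / 4) ^+ n./2.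
  by rewrite -exprMn mulN1r.
by field; rewrite addrC natr1 pnatr_eq0.
Qed.

Lemma U_1 : U 1%N = 1.
Proof.
have := congr1 (fun a : fps rat => a 0%N) fps_deriv_U.
by rewrite /fps_deriv mulr1n /= => ->; rewrite /fps_pow1B /gbinom big_ord0.
Qed.

Lemma rt_0 : rt 0%N = 1.
Proof. by rewrite /fps_pow1B /gbinom big_ord0. Qed.

(** Differentiate [rt_sqr], then divide by [2 rt], that is, multiply by [rti / 2]. *)
Lemma fps_deriv_rt : fps_deriv rt = - (fpsC (1 / 2) * rti * hz).
Proof.
have := congr1 (@fps_deriv _) rt_sqr.
rewrite fps_derivD fps_derivN (fps_derivC 1) !fps_derivM.
rewrite fps_derivC fps_derivX => eq_d.
have := rt_rti; have := fpsC_halfK; move: eq_d.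
set h := fpsC _; set x := fpsX _; set r := rt; set r' := rti; set d := fps_deriv r.
move=> eq_d h2 rr'.
transitivity ((h *+ 2) * (r * r') * d); first by rewrite h2 rr' !mul1r.
transitivity (h * r' * (d * r + r * d)); first by ring.
rewrite eq_d; transitivity (- ((h *+ 2) * (h * r' * (h * x)))); first by ring.
by rewrite h2 mul1r.
Qed.

(** With [z = 2 sin t] these two series are [cos (2 x t)] and [sin (2 x t)]. *)
Definition cosU (x : rat) : fps rat := fps_comp (fps_dilate x fps_cos) U.
Definition sinU (x : rat) : fps rat := fps_comp (fps_dilate x fps_sin) U.

Lemma cosU_0 x : cosU x 0%N = 1.
Proof. by rewrite /cosU fps_comp0 /fps_dilate /fps_cos expr0. Qed.

Lemma sinU_0 x : sinU x 0%N = 0.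
Proof. by rewrite /sinU fps_comp0 /fps_dilate /fps_sin expr0. Qed.

Lemma fps_deriv_cosU x : fps_deriv (cosU x) = - (fpsC x * rti * sinU x).
Proof.
rewrite fps_deriv_comp ?U_0 // fps_deriv_dilate_cos fps_deriv_U fps_compN.
by rewrite fps_compM ?U_0 // fps_compC /sinU; ring.
Qed.

Lemma fps_deriv_sinU x : fps_deriv (sinU x) = fpsC x * rti * cosU x.
Proof.
rewrite fps_deriv_comp ?U_0 // fps_deriv_dilate_sin fps_deriv_U.
by rewrite fps_compM ?U_0 // fps_compC /cosU; ring.
Qed.

(** Both pairs solve the rotation system with speed [rti / 2] and start at [(1, 0)]. *)
Lemma cosU_sinU_half : cosU (1 / 2) = rt /\ sinU (1 / 2) = hz.
Proof.
have [|||| /subr0_eq -> /subr0_eq ->] // := @fps_rotation_uniq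
  (fpsC (1 / 2) * rti) (cosU (1 / 2) - rt) (sinU (1 / 2) - hz).
- by rewrite fpsD fpsN cosU_0 rt_0 subrr.
- by rewrite fpsD fpsN sinU_0 fpsM0 mulr0 subr0.
- by rewrite fps_derivD fps_derivN fps_deriv_cosU fps_deriv_rt; ring.
rewrite fps_derivD fps_derivN fps_deriv_sinU fps_derivM fps_derivC fps_derivX.
by ring: rt_rti.
Qed.

(** Both sides solve the rotation system with speed [(x + y) rti] and have the same constant
    terms. *)
Lemma cosU_sinU_add x y :
  cosU (x + y) = cosU x * cosU y - sinU x * sinU y /\
  sinU (x + y) = sinU x * cosU y + cosU x * sinU y.
Proof.
have [|||| /subr0_eq -> /subr0_eq ->] // := @fps_rotation_uniq
  (fpsC (x + y) * rti) (cosU (x + y) - (cosU x * cosU y - sinU x * sinU y))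
  (sinU (x + y) - (sinU x * cosU y + cosU x * sinU y)).
- by rewrite !(fpsD, fpsN, fpsM0) !cosU_0 !sinU_0; ring.
- by rewrite !(fpsD, fpsN, fpsM0) !cosU_0 !sinU_0; ring.
- rewrite !(fps_derivD, fps_derivN, fps_derivM) !fps_deriv_cosU !fps_deriv_sinU.
  by rewrite rmorphD; ring.
rewrite !(fps_derivD, fps_derivN, fps_derivM) !fps_deriv_cosU !fps_deriv_sinU.
by rewrite rmorphD; ring.
Qed.

(* The polynomials [sin (2 m t) / cos t] and [cos ((2 m + 1) t) / cos t] in
   [z = 2 sin t]. *)
Fixpoint cheb (m : nat) : fps rat * fps rat :=
  if m is m'.+1 then
    let: (s, c) := cheb m' in
    (s + fpsX rat * c, c - fpsX rat * (s + fpsX rat * c))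
  else (0, 1).

Lemma cheb1S m : (cheb m.+1).1 = (cheb m).1 + fpsX rat * (cheb m).2.
Proof. by rewrite /=; case: cheb. Qed.

Lemma cheb2S m : (cheb m.+1).2 = (cheb m).2 - fpsX rat * (cheb m.+1).1.
Proof. by rewrite /=; case: cheb. Qed.

Lemma cheb2_0 m : (cheb m).2 0%N = 1.
Proof. by elim: m => // m IH; rewrite cheb2S fpsD fpsN fpsXM IH subr0. Qed.

Lemma cosU_sinU_cheb m : cosU (m%:R + 1 / 2) = rt * (cheb m).2 /\
  sinU (m%:R + 1 / 2) = (cheb m).1 + hz * (cheb m).2.
Proof.
have [c0 s0] := cosU_sinU_half.
have [c1 s1] := cosU_sinU_add (1 / 2) (1 / 2).
elim: m => [|m [IHc IHs]]; first by rewrite /= add0r c0 s0; split; ring.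
(* One step of [cheb] adds [2 t] to the angle, which is [1 = 1/2 + 1/2] in the parameter of
   [cosU]. *)
have -> : m.+1%:R + 1 / 2 = (m%:R + 1 / 2) + (1 / 2 + 1 / 2) :> rat.
  by rewrite -natr1; field.
have [-> ->] := cosU_sinU_add (m%:R + 1 / 2) (1 / 2 + 1 / 2).
rewrite c1 s1 c0 s0 IHc IHs cheb2S cheb1S.
have := rt_sqr; have := fpsX_half; set r := rt; set h := hz => -> rr.
by split; ring: rr.
Qed.

Lemma sec_tan_exists : exists h : fps rat, h * fps_cos = 1 + fps_sin.
Proof.
have [|b b_inv] := @fps_inv_exists rat fps_cos; first by rewrite /fps_cos divr1.
by exists ((1 + fps_sin) * b); rewrite -mulrA b_inv mulr1.
Qed.

(** This is [h cos = 1 + sin] taken at [(m + 1/2) U]; the cosine there is [rt * (cheb m).2]. *)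
Lemma sec_tan_cheb (h : fps rat) (m : nat) : h * fps_cos = 1 + fps_sin ->
  (cheb m).2 * (rt * fps_comp (fps_dilate (m%:R + 1 / 2) h) U)
  = 1 + (cheb m).1 + hz * (cheb m).2.
Proof.
move=> /(congr1 (fps_dilate (m%:R + 1 / 2))).
rewrite fps_dilateM fps_dilateD fps_dilate1 => /(congr1 (fun a => fps_comp a U)).
have [ec es] := cosU_sinU_cheb m.
rewrite fps_compM ?U_0 // fps_compD fps_comp1 -/(cosU _) -/(sinU _) ec es => eq_h.
by rewrite -addrA -eq_h mulrCA mulrA mulrC.
Qed.

(** * Order preserving maps on the zigzag poset *)

Lemma card_tuple_cons (A : finType) (m : nat) (S : pred (seq A)) :
  #|[set t : m.+1.-tuple A | S t]|
  = (\sum_a #|[set t : m.-tuple A | S (a :: t)]|)%N.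
Proof.
under eq_bigr do rewrite -sum1_card.
rewrite pair_big_dep -sum1_card /=.
rewrite (reindex (fun p : A * m.-tuple A => [tuple of p.1 :: p.2])) /=.
  by apply: eq_bigl => p; rewrite !inE.
exists (fun t : m.+1.-tuple A => (thead t, [tuple of behead t])) => [[a t] _ | t _].
  by congr pair; rewrite ?theadE //; apply: val_inj.
by rewrite /= -tuple_eta.
Qed.

(* [zwalk t m j] counts the sequences [g_0, ..., g_m] in [0, t - 1] with
   [g_0 = j - 1] and [g_i + g_(i+1) >= t - 1] for all [i]. *)
Fixpoint zwalk (t m j : nat) : nat :=
  if m is m'.+1 then (\sum_(i < j) zwalk t m' (t - i))%N else 1%N.

Definition zwalk_rel (t : nat) : rel 'I_t.+1 := fun a b => (t <= a + b)%N.

Lemma card_path_zwalk (t m : nat) (a : 'I_t.+1) :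
  #|[set s : m.-tuple 'I_t.+1 | path (@zwalk_rel t) a s]| = zwalk t.+1 m a.+1.
Proof.
elim: m a => [|m IH] a.
  rewrite /= (_ : [set _ | _] = setT) ?cardsT ?card_tuple //.
  by apply/setP => s; rewrite !inE tuple0.
rewrite (card_tuple_cons m (path (@zwalk_rel t) a)) /=.
(* Index [i] of the recursion stands for the next value [t - i]; the sum is extended to all of
   ['I_t.+1] and reversed to run over that value. *)
rewrite (big_ord_widen t.+1 (fun i => zwalk t.+1 m (t.+1 - i))) //.
rewrite [RHS](reindex_inj rev_ord_inj) [RHS]big_mkcond /=; apply: eq_bigr => b _.
have lt_b := ltn_ord b; have -> : (t.+1 - (t.+1 - b.+1) = b.+1)%N by lia.
rewrite -IH; case: ifP => ab; last first.
  apply/eqP; rewrite cards_eq0 -subset0; apply/subsetP => s; rewrite !inE /zwalk_rel.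
  by move=> /andP[/= ab' _]; move: ab; lia.
apply: eq_card => s; rewrite !inE /zwalk_rel (_ : (t <= a + b)%N = true) //.
by move: ab; lia.
Qed.

(** The first term is free, as if it were preceded by the maximal value [t]; hence [n] steps from
    [t.+1]. *)
Lemma card_sorted_zwalk (t n : nat) :
  #|[set s : n.-tuple 'I_t.+1 | sorted (@zwalk_rel t) s]| = zwalk t.+1 n t.+1.
Proof.
case: n => [|n].
  rewrite /= (_ : [set _ | _] = setT) ?cardsT ?card_tuple //.
  by apply/setP => s; rewrite !inE tuple0.
rewrite (card_tuple_cons n (sorted (@zwalk_rel t))) /=.
under eq_bigr do rewrite card_path_zwalk.
rewrite [RHS](reindex_inj rev_ord_inj) /=; apply: eq_bigr => b _.
by congr zwalk; have := ltn_ord b; lia.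
Qed.

(* Reversing the values at every second element turns both kinds of cover
   relations into the single condition [zwalk_rel]. *)
Lemma card_order_preserving_zigzag (t n : nat) :
  #|[set f : {ffun zigzag n -> 'I_t.+1} | order_preserving f]| = zwalk t.+1 n t.+1.
Proof.
rewrite -card_sorted_zwalk.
(* Odd 0-based positions are the minimal elements: a bound [u <= v] with [u] at a minimal element
   reads [t <= (t - u) + v]. *)
pose flip (i : nat) (x : 'I_t.+1) := if odd i then rev_ord x else x.
have flipK i : involutive (flip i).
  by move=> x; rewrite /flip; case: (odd i) => //; rewrite rev_ordK.
pose phi (f : {ffun zigzag n -> 'I_t.+1}) : n.-tuple 'I_t.+1 :=
  [tuple flip i (f i) | i < n].
pose psi (s : n.-tuple 'I_t.+1) : {ffun zigzag n -> 'I_t.+1} :=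
  [ffun i : zigzag n => flip i (tnth s i)].
have phiK : cancel phi psi.
  by move=> f; apply/ffunP => i; rewrite ffunE tnth_mktuple flipK.
have psiK : cancel psi phi.
  by move=> s; apply: eq_from_tnth => i; rewrite tnth_mktuple ffunE flipK.
have phi_bij : {on [set s : n.-tuple 'I_t.+1 | sorted (@zwalk_rel t) s], bijective phi}.
  by apply: onW_bij; exists psi.
rewrite -(on_card_preimset phi_bij); apply: eq_card => f; rewrite !inE.
pose F (x : zigzag n) : nat := f x.
have F_le x : (F x <= t)%N by rewrite -ltnS ltn_ord.
have opP : reflect (forall x y : zigzag n, (x <= y)%O -> (F x <= F y)%N)
                   (order_preserving f).
  apply: (iffP forallP) => [op x y | op x]; first by have /forallP/(_ y)/implyP := op x.
  by apply/forallP => y; apply/implyP; apply: op.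
pose G i x := if odd i then (t - F x)%N else F x.
have nth_phi i (lt_in : (i < n)%N) : nth ord0 (phi f) i = G i (Ordinal lt_in) :> nat.
  rewrite -[i in nth _ _ i]/(nat_of_ord (Ordinal lt_in)) -tnth_nth tnth_mktuple.
  by rewrite /flip /G /=; case: odd => //=; rewrite subSS.
apply/opP/(sortedP ord0) => [op i | srt x y].
  rewrite size_tuple => lt_in; rewrite /zwalk_rel.
  rewrite (nth_phi _ (ltnW lt_in)) (nth_phi _ lt_in).
  set x : zigzag n := Ordinal _; set y : zigzag n := Ordinal _.
  have := op y x; have := op x y; have := F_le x; have := F_le y.
  rewrite !zigzag_leE /zigzag_lt /zidx /G /= !eqxx !orbT !andbT.
  case: (odd i) => /=; rewrite ?orbT => le_y le_x.
    by move=> /(_ isT) le_xy _; lia.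
  by move=> _ /(_ isT); lia.
rewrite zigzag_leE => /orP[/eqP -> //|].
have step (i j : zigzag n) : (i.+1 = j)%N -> (t <= G i i + G j j)%N.
  move=> ij; have lt_in : (i.+1 < n)%N by rewrite ij ltn_ord.
  have := srt i; rewrite size_tuple => /(_ lt_in).
  rewrite /zwalk_rel (nth_phi _ (ltnW lt_in)) (nth_phi _ lt_in).
  have -> : Ordinal (ltnW lt_in) = i by apply: val_inj.
  by have -> : Ordinal lt_in = j by [apply: val_inj]; rewrite ij.
have := F_le x; have := F_le y.
rewrite /zigzag_lt /zidx /= negbK => le_y le_x /andP[ox /orP[] /eqP [e]].
  have := step y x (esym e); rewrite /G ox.
  by move: ox; rewrite e /= => /negbTE ->; lia.
by have := step x y (esym e); rewrite /G ox e /= ox /=; lia.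
Qed.

(** Let [Q j] be the series of walks from [j]. The recursion links [Q m] and [Q (t - m)], so both
    are affine in [Q t] with coefficients built from [cheb]; at [m = t] the value [Q 0 = 1] gives an
    equation for [Q t]. *)
Lemma zwalk_cheb (t : nat) :
  (cheb t).2 * (fun n => (zwalk t n t)%:R : rat) = 1 + (cheb t).1.
Proof.
pose Q (j : nat) : fps rat := fun n => (zwalk t n j)%:R.
have QS j : Q j.+1 = Q j + fpsX rat * Q (t - j)%N.
  apply: fpsP => n; rewrite fpsD fpsXM /Q.
  by case: n => [|n] /=; rewrite ?addr0 // big_ord_recr natrD.
have Q0 : Q 0%N = 1 by apply: fpsP => -[|n]; rewrite fps1 /Q /= ?big_ord0.
suff key m : (m <= t)%N ->
    Q m = Q t * (cheb m).1 + (cheb m).2 + fpsX rat * (cheb m).1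
    /\ Q (t - m)%N = Q t * (cheb m).2 - (cheb m).1.
  have [_] := key t (leqnn t); rewrite subnn Q0 => ->.
  by rewrite -/(Q t); ring.
elim: m => [|m IH] lt_mt; first by rewrite Q0 subn0 /=; split; ring.
have [IH1 IH2] := IH (ltnW lt_mt).
have e1 : Q m.+1 = Q t * (cheb m.+1).1 + (cheb m.+1).2 + fpsX rat * (cheb m.+1).1.
  by rewrite QS IH1 IH2 cheb2S cheb1S; ring.
split=> //; have := QS (t - m.+1)%N.
have -> : ((t - m.+1).+1 = t - m)%N by lia.
have -> : (t - (t - m.+1) = m.+1)%N by lia.
move=> e2; have -> : Q (t - m.+1)%N = Q (t - m)%N - fpsX rat * Q m.+1.
  by rewrite e2 addrK.
by rewrite e1 IH2 cheb2S cheb1S; ring.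
Qed.

Lemma cheb_inj (t : nat) (a b : fps rat) :
  (cheb t).2 * a = (cheb t).2 * b -> a = b.
Proof. by apply: fps_mulI; rewrite cheb2_0. Qed.

(** The factor [(cheb t).2] cancels between [zwalk_cheb] and [sec_tan_cheb]; the summand
    [hz * (cheb t).2] leaves [z / 2], the correction at [n = 1]. *)
Lemma zwalk_sec_tan (h : fps rat) (t n : nat) : h * fps_cos = 1 + fps_sin ->
  (zwalk t n t)%:R + 1 / 2 * (n == 1%N)%:R
  = (rt * fps_comp (fps_dilate (t%:R + 1 / 2) h) U) n.
Proof.
move=> hE; pose F : fps rat := fun n => (zwalk t n t)%:R.
have -> : rt * fps_comp (fps_dilate (t%:R + 1 / 2) h) U = F + hz.
  by apply: (@cheb_inj t); rewrite sec_tan_cheb // mulrDr zwalk_cheb; ring.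
by rewrite fpsD fpsCM.
Qed.

(** * Coefficients of order polynomials *)

Lemma coef_comp_XaddC (p : {poly rat}) (x : rat) (n : nat) :
  (size p <= n.+1)%N -> (p \Po ('X + x%:P))`_n = p`_n.
Proof.
have sz : size ('X + x%:P) = 2%N := size_XaddC x.
have szc : size (p \Po ('X + x%:P)) = size p by rewrite size_comp_poly2.
rewrite leq_eqVlt => /orP[/eqP szp | lt_pn]; last first.
  by rewrite !nth_default ?szc.
have := @lead_coef_comp _ p ('X + x%:P); rewrite !lead_coefE szc sz szp /=.
by rewrite coefD coefX coefC addr0 expr1n mulr1; apply.
Qed.

(** In [zwalk_sec_tan] the number [t] enters only through the dilation, so the count is a polynomial
    in [t + 1/2] whose coefficients can be read off; agreement at all positive integers suffices. *)
Lemma order_poly_zigzag_comp (h : fps rat) (n : nat) :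
  h * fps_cos = 1 + fps_sin ->
  order_poly (zigzag n) = (\poly_(k < n.+1) (h k * (U ^+ k * rt) n)
     - (1 / 2 * (n == 1%N)%:R)%:P) \Po ('X + (1 / 2)%:P).
Proof.
move=> hE; apply: is_order_poly_uniq; first exact: order_polyP.
case=> // t _; rewrite horner_comp hornerD hornerN !hornerC hornerD hornerX hornerC.
rewrite card_order_preserving_zigzag; apply/eqP; rewrite subr_eq; apply/eqP.
rewrite (zwalk_sec_tan _ _ hE) horner_poly fpsM.
under [RHS]eq_bigr => i _ do
  rewrite (@fps_comp_widen _ _ _ (n - i)%N n U_0) ?leq_subr // mulr_sumr.
rewrite exchange_big; apply: eq_bigr => k _ /=.
rewrite [U ^+ k * rt]mulrC fpsM mulr_sumr mulr_suml; apply: eq_bigr => i _.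
by rewrite /fps_dilate; ring.
Qed.

(** * Leading coefficient of the order polynomial of a finite poset *)

Section OrderPolyLeadCoef.
Variables (d : Order.disp_t) (P : finPOrderType d).

Definition order_surj (j : nat) : {set {ffun P -> 'I_j}} :=
  [set f : {ffun P -> 'I_j} | order_preserving f & f @: setT == setT].

Lemma card_order_onto (j t : nat) (e : 'I_j -> 'I_t) :
  (forall x y, (e x <= e y)%N = (x <= y)%N) ->
  #|[set f : {ffun P -> 'I_t} | order_preserving f & f @: setT == e @: setT]|
  = #|order_surj j|.
Proof.
move=> e_mono.
have e_inj : injective e.
  by move=> x y exy; apply/val_inj/anti_leq; rewrite -!e_mono exy leqnn.
pose g (h : {ffun P -> 'I_j}) : {ffun P -> 'I_t} := [ffun x => e (h x)].
have g_im h : g h @: setT = e @: (h @: setT).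
  by rewrite -imset_comp; apply: eq_imset => x; rewrite ffunE.
have g_op h : order_preserving (g h) = order_preserving h.
  by apply: eq_forallb => x; apply: eq_forallb => y; rewrite !ffunE e_mono.
have g_inj : injective g.
  by move=> h h' /ffunP E; apply/ffunP => x; have := E x; rewrite !ffunE => /e_inj.
rewrite -(card_imset _ g_inj); apply: eq_card => f.
apply/idP/imsetP => [|[h]]; rewrite !inE; last first.
  by move=> /andP[op_h /eqP im_h] ->; rewrite g_op op_h g_im im_h eqxx.
move=> /andP[op_f /eqP im_f].
have /fin_all_exists[h fE] (x : P) : exists i, f x = e i.
  have : f x \in e @: setT by rewrite -im_f imset_f.
  by case/imsetP => i _ ->; exists i.
have fg : f = g [ffun x => h x] by apply/ffunP => x; rewrite !ffunE.
exists [ffun x => h x] => //; rewrite inE -g_op -fg op_f /=.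
by apply/eqP/(imset_inj e_inj); rewrite -im_f fg g_im.
Qed.

(** Maps are sorted by their image [A]. Listing [A] in increasing order shows that their number
    depends on [#|A|] alone, and ['C(t, j)] images have size [j]. *)
Lemma card_order_preserving (t : nat) :
  #|[set f : {ffun P -> 'I_t} | order_preserving f]|
  = (\sum_(j < #|P|.+1) #|order_surj j| * 'C(t, j))%N.
Proof.
have surj0 j : (#|P| < j)%N -> #|order_surj j| = 0%N.
  move=> lt_Pj; apply/eqP; rewrite cards_eq0 -subset0; apply/subsetP => f.
  rewrite !inE => /andP[_ /eqP /(congr1 (fun S : {set 'I_j} => #|S|))].
  rewrite cardsT card_ord => im_f; move: lt_Pj.
  by rewrite -im_f ltnNge -cardsT leq_imset_card.
transitivity (\sum_(A : {set 'I_t}) #|order_surj #|A| |)%N.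
  rewrite -sum1_card (partition_big (fun f : {ffun P -> 'I_t} => f @: setT) predT) //=.
  apply: eq_bigr => A _.
  pose e (i : 'I_#|A|) : 'I_t := Order.enum_val i.
  have tot : total (<=%O : rel 'I_t) by move=> i j; exact: leq_total.
  have e_im : A = e @: setT.
    apply/setP => i; apply/idP/imsetP => [iA | [j _ ->]]; last exact: Order.enum_valP.
    by exists (Order.enum_rank_in iA i); rewrite // /e Order.enum_rankK_in.
  rewrite -(@card_order_onto _ _ e) => [|x y]; last exact: (Order.le_enum_val tot).
  by rewrite -sum1_card; apply: eq_bigl => f; rewrite !inE -e_im.
(* A common bound for the sizes of images and for the range of [j] in the goal. *)
pose M := maxn #|P| t.
rewrite (big_ord_widen M.+1 (fun j => #|order_surj j| * 'C(t, j))%N) ?ltnS ?leq_maxl //.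
rewrite [RHS]big_mkcond.
rewrite (partition_big (fun A : {set 'I_t} => inord #|A| : 'I_M.+1) predT) //=.
apply: eq_bigr => j _; rewrite -[t in 'C(t, _)]card_ord -card_draws.
have cardM (A : {set 'I_t}) : (#|A| < M.+1)%N.
  by rewrite ltnS (leq_trans (max_card _)) // card_ord leq_maxr.
transitivity (\sum_(A in [set A : {set 'I_t} | #|A| == j]) #|order_surj j|)%N.
  apply: eq_big => [A | A /eqP <-]; last by rewrite inordK.
  by rewrite inE -val_eqE /= inordK.
rewrite sum_nat_const mulnC; case: ifP => // /negbT; rewrite -leqNgt => lt_Pj.
by rewrite surj0.
Qed.

Let bin_poly (j : nat) : {poly rat} :=
  (j`!%:R)^-1 *: \prod_(i <- iota 0 j) ('X - i%:R%:P).

Let horner_bin_poly (j t : nat) : (bin_poly j).[t%:R] = 'C(t, j)%:R.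
Proof.
rewrite hornerZ horner_prod; apply: (mulfI (x := j`!%:R)).
  by rewrite pnatr_eq0 -lt0n fact_gt0.
rewrite mulVKf ?pnatr_eq0 -?lt0n ?fact_gt0 // -natrM mulnC bin_ffact.
have -> : iota 0 j = index_iota 0 j by rewrite /index_iota subn0.
elim: j => [|j IHj]; first by rewrite big_nil ffactn0.
rewrite big_nat_recr //= IHj hornerXsubC ffactnSr natrM.
case: (leqP j t) => [le_jt | lt_tj]; first by rewrite natrB.
by rewrite ffact_small // !mul0r.
Qed.

(** In the binomial basis only the summand [j = #|P|] reaches degree [#|P|], and surjections onto
    ['I_#|P|] are bijections. *)
Lemma coef_order_poly_card :
  (order_poly P)`_#|P| = #|linear_extensions P|%:R / #|P|`!%:R.
Proof.
have -> : order_poly P = \sum_(j < #|P|.+1) #|order_surj j|%:R *: bin_poly j.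
  apply: is_order_poly_uniq; first exact: order_polyP.
  move=> t _; rewrite card_order_preserving horner_sum natr_sum.
  by apply: eq_bigr => j _; rewrite hornerZ horner_bin_poly natrM.
have size_prod j : size (\prod_(i <- iota 0 j) ('X - (i%:R : rat)%:P)) = j.+1.
  by rewrite size_prod_XsubC size_iota.
rewrite coef_sum big_ord_recr /= big1 ?add0r => [|j _]; last first.
  by rewrite !coefZ nth_default ?mulr0 // size_prod.
rewrite !coefZ; have -> : order_surj #|P| = linear_extensions P.
  apply/setP => f; rewrite !inE andbC; congr andb; apply/eqP/injectiveP.
    move=> im_f; have /imset_injP f_inj : #|f @: setT| == #|[set: P]|.
      by rewrite im_f !cardsT card_ord.
    by move=> x y; apply: f_inj; rewrite inE.
  move=> f_inj; apply/eqP; rewrite eqEcard subsetT card_imset // !cardsT.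
  by rewrite card_ord /=; exact: leqnn.
have lead1 j : (\prod_(i <- iota 0 j) ('X - (i%:R : rat)%:P))`_j = 1.
  have /monicP := monic_prod_XsubC (iota 0 j) predT (fun i => i%:R : rat).
  by rewrite lead_coefE size_prod.
by rewrite lead1 mulr1.
Qed.

End OrderPolyLeadCoef.

(** The top coefficient of the order polynomial of [zigzag k] is computed twice: by linear
    extensions, and as [h k] because [U ^+ k * rt] begins with [z^k]. The shift by 1/2 does not
    affect it. *)
Lemma sec_tan_coef (h : fps rat) (k : nat) : h * fps_cos = 1 + fps_sin ->
  (0 < k)%N -> h k = (euler_number k)%:R / k`!%:R.
Proof.
move=> hE k0; have := coef_order_poly_card (zigzag k).
rewrite -/(euler_number k) (_ : #|{: zigzag k}| = k); last exact: card_ord.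
move=> <-; rewrite (order_poly_zigzag_comp _ hE) coef_comp_XaddC; last first.
  rewrite (leq_trans (size_polyD _ _)) // geq_max size_poly size_polyN.
  by rewrite (leq_trans (size_polyC_leq1 _)).
rewrite coefB coefC (gtn_eqF k0) coef_poly ltnSn subr0.
rewrite fpsM big_ord_recr /= subnn rt_0 fps_expr_diag ?U_0 // U_1 expr1n.
rewrite big1 ?add0r ?mulr1 // => i _.
by rewrite fps_expr_small ?mul0r ?U_0.
Qed.

Lemma coef_order_poly_zigzag (n k : nat) : (0 < k <= n)%N ->
  (order_poly (zigzag n) \Po ('X - (1 / 2)%:P))`_k
  = (euler_number k)%:R / k`!%:R * (U ^+ k * rt) n.
Proof.
case/andP=> k0 le_kn; have [h hE] := sec_tan_exists.
have shiftK : ('X + (1 / 2)%:P) \Po ('X - (1 / 2)%:P) = 'X :> {poly rat}.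
  by rewrite comp_polyD comp_polyX comp_polyC subrK.
rewrite (order_poly_zigzag_comp _ hE) -comp_polyA shiftK comp_polyXr coefB coefC coef_poly.
rewrite ltnS le_kn (gtn_eqF k0) subr0.
by rewrite (sec_tan_coef hE).
Qed.

(** * Decompositions into intervals *)

Definition fps_parity (b : bool) (a : fps rat) : Prop :=
  forall n, odd n != b -> a n = 0.

Lemma fps_parityM (b c : bool) (x y : fps rat) :
  fps_parity b x -> fps_parity c y -> fps_parity (b (+) c) (x * y).
Proof.
move=> px py n on; rewrite fpsM big1 // => i _.
case: (eqVneq (odd i) b) => [oi | /px ->]; last by rewrite mul0r.
rewrite (py (n - i)%N) ?mulr0 //; apply: contraNneq on => <-.
by rewrite oddB ?leq_ord // oi addbCA addbb addbF.
Qed.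

Lemma U_parity : fps_parity true U.
Proof.
case=> [|n]; first by rewrite U_0.
rewrite /U_ /fps_dilate /fps_arcsin /fps_int /fps_pow1B /=.
by case: (odd n) => //= _; rewrite mul0r !mulr0.
Qed.

Lemma fps_pow1B_parity (x c : rat) : fps_parity false (fps_pow1B x c).
Proof. by move=> n; rewrite /fps_pow1B; case: odd. Qed.

Lemma UX_parity (k : nat) : fps_parity (odd k) (U ^+ k).
Proof.
elim: k => [|k IH]; first by move=> [|n]; rewrite expr0 fps1.
by rewrite exprS /= -addTb; apply: fps_parityM => //; apply: U_parity.
Qed.

Lemma bigminn_le (T : eqType) (s : seq T) (P : pred T) (F : T -> nat) (d : nat) x :
  x \in s -> P x -> (\big[minn/d]_(y <- s | P y) F y <= F x)%N.
Proof.
move=> + Px; elim: s => // y s IH; rewrite inE big_cons => /orP[/eqP <- | /IH le_x].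
  by rewrite Px geq_minl.
by case: ifP => // _; rewrite geq_min le_x orbT.
Qed.

Section Decompositions.
Variable N : nat.

(* 0-based: [seg m] is [z_1, ..., z_m] and [blk a m] is [z_(a+1), ..., z_m]. *)
Definition seg (m : nat) : {set zigzag N} := [set x : zigzag N | (x < m)%N].
Definition blk (a m : nat) : {set zigzag N} := [set x : zigzag N | (a <= x < m)%N].

(** Initial segments make removal of the last block recursive; [N] stays fixed because [special]
    refers to it. *)
Definition Dec (k m : nat) : {set {set {set zigzag N}}} :=
  [set mu : {set {set zigzag N}} |
     [&& partition mu (seg m), #|mu| == k & [forall B in mu, interval_block B]]].

(** The case [m <= a] gives the empty set, which only the partition condition excludes. *)
Lemma interval_blockP (B : {set zigzag N}) :
  reflect (exists a m, [/\ (a < N)%N, (0 < m <= N)%N & B = blk a m]) (interval_block B).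
Proof.
apply: (iffP existsP) => [[a /existsP[b /eqP ->]] | [a [m [lt_aN m_bd ->]]]].
  by exists a, b.+1; rewrite ltn_ord ltn_ord.
have lt_mN : (m.-1 < N)%N by lia.
exists (Ordinal lt_aN); apply/existsP; exists (Ordinal lt_mN); apply/eqP/setP => x.
by rewrite !inE /zidx /=; lia.
Qed.

Section Block.
Variables (a m : nat).
Hypotheses (lt_am : (a < m)%N) (le_mN : (m <= N)%N).

Let first_elt : zigzag N := Ordinal (leq_trans lt_am le_mN).
Let lt_last : (m.-1 < N)%N. Proof. by lia. Qed.
Let last_elt : zigzag N := Ordinal lt_last.

Lemma block_first_blk : block_first (blk a m) = a.+1.
Proof.
apply/eqP; rewrite eqn_leq; apply/andP; split.
  apply: (@bigminn_le _ _ _ _ _ first_elt); first by rewrite mem_index_enum.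
  by rewrite inE /= leqnn.
(* The default value [N] of the minimum is at least [a.+1]. *)
rewrite /block_first; elim/big_ind: _ => [|x y lx ly|x]; first by lia.
  by rewrite leq_min lx ly.
by rewrite inE /zidx ltnS => /andP[].
Qed.

Lemma block_last_blk : block_last (blk a m) = m.
Proof.
apply/eqP; rewrite eqn_leq; apply/andP; split.
  by apply/bigmax_leqP => x; rewrite inE /zidx => /andP[].
have lastE : zidx last_elt = m by rewrite /zidx /=; lia.
by rewrite -[leqLHS]lastE /block_last (bigD1 last_elt) ?leq_maxl // inE /=; lia.
Qed.

Lemma block_weight_blk : block_weight (blk a m) =
  if ~~ odd (m - a) then 0
  else if ~~ odd a then w_minus (m - a)
  else if ~~ odd N && (m == N) then U_ (m - a)
  else w_plus (m - a).
Proof.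
rewrite /block_weight /special /block_size block_first_blk block_last_blk.
by have -> : (m - a.+1).+1 = (m - a)%N by lia.
Qed.

Lemma blk_neq0 : blk a m != set0.
Proof. by apply/set0Pn; exists first_elt; rewrite inE /= leqnn. Qed.

Lemma blk_disjoint_seg : [disjoint blk a m & seg a].
Proof.
rewrite -setI_eq0 -subset0; apply/subsetP => x.
by rewrite !inE; lia.
Qed.

Lemma blkU_seg : blk a m :|: seg a = seg m.
Proof. by apply/setP => x; rewrite !inE; lia. Qed.

Lemma blk_notin_Dec k mu : mu \in Dec k a -> blk a m \notin mu.
Proof.
rewrite inE => /and3P[part _ _]; apply/negP => /(partitionS part) sub.
have := blk_disjoint_seg; rewrite -setI_eq0 (setIidPl sub).
by rewrite (negbTE blk_neq0).
Qed.

(** Shaped for [reindex_onto]: the equation on the left encodes that [blk a m] is not in [mu]. *)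
Lemma Dec_addblock k mu :
  (blk a m |: mu \in Dec k.+1 m) && ((blk a m |: mu) :\ blk a m == mu)
  = (mu \in Dec k a).
Proof.
have D_seg : seg m :\: blk a m = seg a.
  by apply/setP => x; rewrite !inE; have := ltn_ord x; lia.
apply/andP/idP => [[]|mu_dec].
  rewrite !inE => /and3P[part /eqP card /forall_inP int] /eqP mu_eq.
  have notin : blk a m \notin mu by rewrite -mu_eq !inE eqxx.
  rewrite -{1}mu_eq -D_seg partitionD1 ?setU11 //=; apply/andP; split.
    by move: card; rewrite cardsU1 notin add1n => -[->].
  by apply/forall_inP => B Bmu; apply: int; rewrite setU1r.
have notin := blk_notin_Dec mu_dec.
rewrite setU1K // eqxx; split=> //.
move: mu_dec; rewrite !inE => /and3P[part /eqP card /forall_inP int].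
rewrite -blkU_seg partitionU1 ?blk_neq0 ?blk_disjoint_seg //= cardsU1 notin card.
rewrite add1n eqxx /=; apply/forall_inP => B /setU1P[-> | /int //].
by apply/interval_blockP; exists a, m; split=> //; lia.
Qed.

End Block.

(** The block of the last element of [seg m] ends there. Two blocks ending there share that element,
    hence coincide, and [block_first] recovers [a]. *)
Lemma Dec_last_block k m mu : (0 < m <= N)%N -> mu \in Dec k m ->
  exists a : 'I_m, (fun b : 'I_m => blk b m \in mu) =1 pred1 a.
Proof.
move=> m_bd; rewrite inE => /and3P[part _ /forall_inP int].
have lt_mN : (m.-1 < N)%N by lia.
pose x : zigzag N := Ordinal lt_mN.
have x_cov : x \in cover mu by rewrite (cover_partition part) inE /=; lia.
have tri := partition_trivIset part.
have Bmu := pblock_mem x_cov; have xB : x \in pblock mu x by rewrite mem_pblock.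
have /interval_blockP[a [l [lt_aN l_bd BE]]] := int _ Bmu.
have sub := partitionS part Bmu.
have lm : l = m.
  have lt_lN : (l.-1 < N)%N by lia.
  move: xB; rewrite BE inE /= => xB.
  have /(subsetP sub) : (Ordinal lt_lN : zigzag N) \in pblock mu x.
    by rewrite BE inE /=; lia.
  by rewrite inE /=; lia.
rewrite {}lm {l_bd} in BE.
have lt_am : (a < m)%N by move: xB; rewrite BE inE /=; lia.
exists (Ordinal lt_am) => b /=; apply/idP/eqP => [bmu | ->]; last by rewrite /= -BE.
have lt_bm := ltn_ord b.
have xb : x \in blk b m by rewrite inE /=; lia.
have := def_pblock tri bmu xb; rewrite BE => eq_blk.
apply: val_inj => /=; apply/eqP; rewrite -eqSS; apply/eqP.
have le_mN : (m <= N)%N by case/andP: m_bd.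
by rewrite -(block_first_blk lt_bm le_mN) -(block_first_blk lt_am le_mN) eq_blk.
Qed.

Lemma sum_DecS k m : (m <= N)%N ->
  \sum_(mu in Dec k.+1 m) weight mu
  = \sum_(a < m) (\sum_(mu in Dec k a) weight mu) * block_weight (blk a m).
Proof.
case: (posnP m) => [-> _ | m0 le_mN].
  rewrite big_ord0; apply: big1 => mu; rewrite inE => /and3P[].
  have -> : seg 0 = set0 by apply/setP => x; rewrite !inE.
  by rewrite partition_set0 => /eqP ->; rewrite cards0.
(* The inner sum has a single term, the start of the last block. *)
transitivity (\sum_(mu in Dec k.+1 m) \sum_(a < m | blk a m \in mu) weight mu).
  apply: eq_bigr => mu /Dec_last_block; rewrite m0 le_mN => /(_ isT)[a ea].
  by rewrite (big_pred1 a).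
rewrite (exchange_big_dep xpredT) //=; apply: eq_bigr => a _.
have lt_am := ltn_ord a.
rewrite (reindex_onto (fun mu => blk a m |: mu) (fun mu => mu :\ blk a m)) /=.
  rewrite mulr_suml; apply: eq_big => [mu | mu].
    by rewrite setU11 andbT Dec_addblock.
  rewrite setU11 andbT Dec_addblock // => mu_dec.
  by rewrite /weight big_setU1 ?(blk_notin_Dec lt_am le_mN mu_dec) // mulrC.
by move=> mu /andP[_ mem]; rewrite setD1K.
Qed.

Lemma sum_Dec0 m : (m <= N)%N ->
  \sum_(mu in Dec 0 m) weight mu = (m == 0%N)%:R.
Proof.
move=> le_mN; have Dec_set0 mu : mu \in Dec 0 m -> mu = set0.
  by rewrite inE => /and3P[_ /eqP/cards0_eq].
case: (posnP m) => [-> | m0].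
  rewrite (big_pred1 set0) => [|mu]; first by rewrite /weight big_set0.
  have seg0 : seg 0 = set0 by apply/setP => x; rewrite !inE.
  rewrite inE seg0 partition_set0; apply/and3P/eqP => [[/eqP] // | -> /=].
  by rewrite cards0 eqxx; split=> //; apply/forall_inP => B; rewrite inE.
rewrite big_pred0 ?(gtn_eqF m0) // => mu; apply/negP => mu_dec.
have := Dec_set0 _ mu_dec; move: mu_dec; rewrite inE => /and3P[part _ _] mu0.
have lt_mN : (m.-1 < N)%N by lia.
have : (Ordinal lt_mN : zigzag N) \in cover mu.
  by rewrite (cover_partition part) inE /=; lia.
by rewrite mu0 /cover big_set0 inE.
Qed.

(* The generating series of the decompositions into [k] blocks none of which is
   special: the blocks have odd sizes, so their weights alternate between
   [W_- = U rt] and [W_+ = U rti]. *)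
Definition dec_series (k : nat) : fps rat := if odd k then U ^+ k * rt else U ^+ k.

Lemma dec_series_parity k : fps_parity (odd k) (dec_series k).
Proof.
rewrite /dec_series; case: ifP => ok; last by rewrite -ok; apply: UX_parity.
rewrite -[true]/(true (+) false) -{1}ok; apply: fps_parityM; first exact: UX_parity.
exact: fps_pow1B_parity.
Qed.

Lemma dec_seriesS k :
  dec_series k.+1 = dec_series k * (if odd k then w_plus else w_minus).
Proof.
rewrite /dec_series -[w_plus]/(U * rti) -[w_minus]/(U * rt) /= exprS.
case: odd => /=; last by ring.
by rewrite mulrACA rt_rti mulr1 mulrC.
Qed.

(** By parity [a] contributes only if it has the parity of [k], and this parity selects [w_minus] or
    [w_plus] for the next block. *)
Lemma sum_dec_seriesS k m : (m <= N)%N -> ~~ (~~ odd N && (m == N)) ->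
  \sum_(a < m) dec_series k a * block_weight (blk a m) = dec_series k.+1 m.
Proof.
move=> le_mN nspec; rewrite dec_seriesS.
pose w : fps rat := if odd k then w_plus else w_minus.
have pw : fps_parity true w.
  rewrite /w -[w_plus]/(U * rti) -[w_minus]/(U * rt) -[true]/(true (+) false).
  by case: odd; apply: fps_parityM (U_parity) (@fps_pow1B_parity _ _).
rewrite -/w fpsM big_ord_recr /= subnn pw // mulr0 addr0.
apply: eq_bigr => a _; have lt_am := ltn_ord a.
case: (eqVneq (odd a) (odd k)) => [oa | /dec_series_parity ->]; last by rewrite !mul0r.
rewrite block_weight_blk // (negbTE nspec) oa; congr (_ * _).
by case: (boolP (odd (m - a))) => o; [rewrite /w; case: odd | rewrite pw // eqb_id].
Qed.

(** Because [m < N], no block reaches the right end, so none is special. *)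
Lemma sum_Dec k m : (m < N)%N -> \sum_(mu in Dec k m) weight mu = dec_series k m.
Proof.
elim: k m => [|k IH] m lt_mN.
  by rewrite sum_Dec0 1?ltnW // /dec_series /= expr0 fps1.
rewrite sum_DecS 1?ltnW // -sum_dec_seriesS 1?ltnW ?(ltn_eqF lt_mN) ?andbF //.
by apply: eq_bigr => a _; rewrite IH // (ltn_trans (ltn_ord a)).
Qed.

Lemma SDecompoE k : SDecompo k N = Dec k N.
Proof.
have -> : Dec k N = SDecompo k N => //; rewrite /Dec /SDecompo.
by have -> : seg N = [set: zigzag N] by apply/setP => x; rewrite !inE ltn_ord.
Qed.

Lemma sum_SDecompo k : (0 < k)%N ->
  \sum_(mu in SDecompo k N) weight mu = (U ^+ k * rt) N.
Proof.
case: k => // k _; rewrite SDecompoE sum_DecS //.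
have Urt_parity : fps_parity (odd k.+1) (U ^+ k.+1 * rt).
  by rewrite -[odd k.+1]addbF; apply: fps_parityM (@UX_parity _) (@fps_pow1B_parity _ _).
under eq_bigr => a _ do rewrite sum_Dec //.
have [oN | eN] := boolP (odd N).
  (* For odd [N] no block is special; if [k.+1] is even, both sides vanish by parity. *)
  rewrite sum_dec_seriesS ?oN // {1}/dec_series; case: ifP => // ok.
  by rewrite UX_parity ?oN ?ok // Urt_parity ?oN ?ok.
(* For even [N], an odd number [k] of earlier blocks makes the last one special, and its weight [U]
   keeps the factor [rt] that [w_plus] would cancel. *)
have [ok | ek] := boolP (odd k).
  have -> : U ^+ k.+1 * rt = dec_series k * U by rewrite /dec_series ok exprS; ring.
  rewrite fpsM big_ord_recr /= subnn U_0 mulr0 addr0; apply: eq_bigr => a _.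
  case: (eqVneq (odd a) (odd k)) => [oa | /dec_series_parity ->]; last by rewrite !mul0r.
  rewrite block_weight_blk // eN eqxx oa ok /= oddB 1?ltnW // (negbTE eN) oa ok.
  by [].
(* An even number of earlier blocks would leave a last block of even size, which has weight 0. *)
rewrite Urt_parity ?(negbTE eN) /= ?ek // big1 // => a _.
case: (eqVneq (odd a) (odd k)) => [oa | /dec_series_parity ->]; last by rewrite mul0r.
by rewrite block_weight_blk // oddB 1?ltnW // (negbTE eN) oa (negbTE ek) mulr0.
Qed.

End Decompositions.

Theorem theorem4p17 (n k : nat) (hn : (2 <= n)%N) (hk : (1 <= k <= n)%N) :
  let c : rat := (order_poly (zigzag n) \Po ('X - (1 / 2)%:P))`_k in
  n`!%:R * c
    = n`!%:R / k`!%:R * (euler_number k)%:R * \sum_(mu in SDecompo k n) weight mu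
  /\ c = (euler_number k)%:R / k`!%:R * \sum_(mu in SDecompo k n) weight mu.
Proof.
move=> c; have cE : c = (euler_number k)%:R / k`!%:R * \sum_(mu in SDecompo k n) weight mu.
  by rewrite /c coef_order_poly_zigzag // sum_SDecompo //; case/andP: hk.
split=> //; rewrite cE; ring.
Qed.
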